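(* Let $\mathcal{H}=\mathcal{H}_1\oplus\mathcal{H}_2$ be a product Hilbert space and $$\mathcal{A}=\begin{pmatrix}A&0\\C&D\end{pmatrix}$$ a lower triangular operator matrix in $\mathcal{H}$ such that $A$ (in $\mathcal{H}_1$) and $D$ (in $\mathcal{H}_2$) are densely defined, $C$ (from $\mathcal{H}_1$ to $\mathcal{H}_2$) and $D$ are closable, $\operatorname{dom}(A)\subset\operatorname{dom}(C)$ and $\rho(A)\ne\emptyset$. Then $$\big(\sigma_{e2}(A)\setminus\sigma_{e2}^*(\overline{D})\big)\cup\sigma_{e2}(\overline{D})\subset\sigma_{e2}(\overline{\mathcal{A}})\subset\sigma_{e2}(A)\cup\sigma_{e2}(\overline{D}),$$ and hence $$\sigma_{e2}(\overline{\mathcal{A}})\cup\big(\sigma_{e2}(A)\cap\sigma_{e2}^*(\overline{D})\big)=\sigma_{e2}(A)\cup\sigma_{e2}(\overline{D});$$ in particular, if $\sigma_{e2}^*(\overline{D})=\sigma_{e2}(\overline{D})$ or if $\sigma_{e2}(A)\cap\sigma_{e2}^*(\overline{D})=\emptyset$, then $$\sigma_{e2}(\overline{\mathcal{A}})=\sigma_{e2}(A)\cup\sigma_{e2}(\overline{D}).$$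
   Context: The domain of $\mathcal{A}$ is $\operatorname{dom}(A)\oplus\operatorname{dom}(D)$. Under the stated assumptions $\mathcal{A}$ is closable with closure $\overline{\mathcal{A}}=\begin{pmatrix}A&0\\C&\overline{D}\end{pmatrix}$ on $\operatorname{dom}(A)\oplus\operatorname{dom}(\overline{D})$. For a closed linear operator $T$: $\sigma_{e2}(T)$ is the set of $\lambda\in\mathbb{C}$ for which it is not true that $\operatorname{ran}(T-\lambda)$ is closed and $\dim\ker(T-\lambda)<\infty$; $\sigma_{e2}^*(T)$ is the set of $\lambda\in\mathbb{C}$ for which it is not true that $\operatorname{ran}(T-\lambda)$ is closed and $\operatorname{codim}\operatorname{ran}(T-\lambda)<\infty$ (for densely defined $T$: $\lambda\in\sigma_{e2}^*(T)$ iff $\overline\lambda\in\sigma_{e2}(T^* )$). *)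

(* Defs.v *)
From HB Require Import structures.
From mathcomp Require Import all_boot all_order all_algebra ring.
From mathcomp Require Import sesquilinear complex.
From mathcomp Require Import boolp classical_sets functions reals.
From mathcomp Require Import topology normedtype.

Set Implicit Arguments.
Unset Strict Implicit.
Unset Printing Implicit Defensive.

Import Order.TTheory GRing.Theory Num.Theory.
Import numFieldNormedType.Exports.

Local Open Scope classical_set_scope.
Local Open Scope ring_scope.

(** * Complex Hilbert spaces *)

(* The inner product is linear in its first argument; the norm of
   [V : normedModType R[i]] takes its (real, nonnegative) values in [R[i]]. *)
HB.mixin Record CompleteNormedModule_isHilbert (R : realType) V
    of CompleteNormedModule R[i] V := {
  inner : {dot V for (@Num.conj R[i])} ;
  inner_normE : forall x : V, inner x x = `|x| ^+ 2
}.

#[short(type="hilbertType")]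
HB.structure Definition Hilbert (R : realType) :=
  {V of CompleteNormedModule_isHilbert R V & CompleteNormedModule R[i] V}.

(** * Orthogonal direct sum of two Hilbert spaces *)

(* An alias of the product type, because the product in the library carries
   the maximum norm, which is not Hilbertian. *)
Definition hsum (R : realType) (H1 H2 : hilbertType R) : Type := (H1 * H2)%type.

Section HilbertSum.
Variables (R : realType) (H1 H2 : hilbertType R).
Local Notation H := (hsum H1 H2).

HB.instance Definition _ := GRing.Lmodule.copy H (H1 * H2)%type.

Definition hsum_norm (x : H) : R[i] := sqrtC (`|x.1| ^+ 2 + `|x.2| ^+ 2).

Lemma hsum_sq_ge0 (x : H) : 0 <= `|x.1| ^+ 2 + `|x.2| ^+ 2.
Proof. by rewrite addr_ge0 // exprn_ge0. Qed.

Lemma hsum_norm_ge0 (x : H) : 0 <= hsum_norm x.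
Proof. by rewrite sqrtC_ge0 hsum_sq_ge0. Qed.

Lemma hsum_norm_sq (x : H) : hsum_norm x ^+ 2 = `|x.1| ^+ 2 + `|x.2| ^+ 2.
Proof. by rewrite sqrtCK. Qed.

Lemma hsum_normD (x y : H) : hsum_norm (x + y) <= hsum_norm x + hsum_norm y.
Proof.
rewrite -(@ler_pXn2r _ 2) ?nnegrE ?addr_ge0 ?hsum_norm_ge0 //.
rewrite hsum_norm_sq.
set p := hsum_norm x; set q := hsum_norm y.
have -> : (p + q) ^+ 2 = p ^+ 2 + q ^+ 2 + (p * q) *+ 2 by ring.
rewrite /p /q !hsum_norm_sq -/p -/q.
set a := `|x.1|; set b := `|x.2|; set c := `|y.1|; set d := `|y.2|.
have [a0 b0 c0 d0] : [/\ 0 <= a, 0 <= b, 0 <= c & 0 <= d] by rewrite /a /b /c /d; split; apply: normr_ge0.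
apply: (@le_trans _ _ ((a + c) ^+ 2 + (b + d) ^+ 2)).
  by apply: lerD; rewrite ler_pXn2r ?nnegrE ?addr_ge0 ?ler_normD.
have -> : (a + c) ^+ 2 + (b + d) ^+ 2 =
  a ^+ 2 + b ^+ 2 + (c ^+ 2 + d ^+ 2) + (a * c + b * d) *+ 2 by ring.
rewrite lerD2l lerMn2r /=.
have pq0 : 0 <= p * q by rewrite mulr_ge0 ?hsum_norm_ge0.
rewrite -(@ler_pXn2r _ 2) ?nnegrE ?addr_ge0 ?mulr_ge0 ?hsum_norm_ge0 //.
rewrite exprMn /p /q !hsum_norm_sq -/a -/b -/c -/d -subr_ge0.
have -> : (a ^+ 2 + b ^+ 2) * (c ^+ 2 + d ^+ 2) - (a * c + b * d) ^+ 2 =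
  (a * d - b * c) ^+ 2 by ring.
by rewrite real_exprn_even_ge0 // rpredB // rpredM // ger0_real.
Qed.

Lemma hsum_normZ (l : R[i]) (x : H) : hsum_norm (l *: x) = `|l| * hsum_norm x.
Proof.
apply/eqP; rewrite -(@eqrXn2 _ 2) ?mulr_ge0 ?hsum_norm_ge0 //.
by rewrite exprMn !hsum_norm_sq !normrZ !exprMn mulrDr.
Qed.

Lemma hsum_norm_ge1 (x : H) : `|x.1| <= hsum_norm x.
Proof.
by rewrite -(@ler_pXn2r _ 2) ?nnegrE ?hsum_norm_ge0 // hsum_norm_sq lerDl
  exprn_ge0.
Qed.

Lemma hsum_norm_ge2 (x : H) : `|x.2| <= hsum_norm x.
Proof.
by rewrite -(@ler_pXn2r _ 2) ?nnegrE ?hsum_norm_ge0 // hsum_norm_sq lerDr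
  exprn_ge0.
Qed.

Lemma hsum_norm_le (x : H) : hsum_norm x <= `|x.1| + `|x.2|.
Proof.
rewrite -(@ler_pXn2r _ 2) ?nnegrE ?addr_ge0 ?hsum_norm_ge0 // hsum_norm_sq.
by rewrite sqrrD addrAC lerDl mulrn_wge0 // mulr_ge0.
Qed.

Lemma hsum_norm0_eq0 (x : H) : hsum_norm x = 0 -> x = 0.
Proof.
move=> x0; have := hsum_norm_ge1 x; have := hsum_norm_ge2 x.
by rewrite x0 !normr_le0 => /eqP x2 /eqP x1; case: x x1 x2 {x0} => ? ? /= -> ->.
Qed.

HB.instance Definition _ := Lmodule_isNormed.Build R[i] H
  hsum_normD hsum_normZ hsum_norm0_eq0.

Lemma hsum_normE (x : H) : `|x| ^+ 2 = `|x.1| ^+ 2 + `|x.2| ^+ 2.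
Proof. exact: hsum_norm_sq. Qed.

Lemma hsum_complete (F : set_system H) : ProperFilter F -> cauchy F -> cvg F.
Proof.
move=> FF /cauchyP Fc.
have cF1 : cvg ((fun x : H => x.1) @ F).
  apply: cauchy_cvg; apply/cauchyP => e /Fc[x Fx]; exists x.1.
  suff: F [set y : H | ball x.1 e y.1] by [].
  apply: filterS Fx => y; rewrite -!ball_normE /=.
  by apply: le_lt_trans; exact: (hsum_norm_ge1 (x - y)).
have cF2 : cvg ((fun x : H => x.2) @ F).
  apply: cauchy_cvg; apply/cauchyP => e /Fc[x Fx]; exists x.2.
  suff: F [set y : H | ball x.2 e y.2] by [].
  apply: filterS Fx => y; rewrite -!ball_normE /=.
  by apply: le_lt_trans; exact: (hsum_norm_ge2 (x - y)).
move: cF1 cF2 => /cvg_ex[l1 Fl1] /cvg_ex[l2 Fl2].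
apply/cvg_ex; exists ((l1, l2) : H).
apply/fcvgrPdist_lt => e e0.
have e20 : 0 < e / 2 by rewrite divr_gt0.
have /cvgrPdist_lt /(_ _ e20) F1 := Fl1.
have /cvgrPdist_lt /(_ _ e20) F2 := Fl2.
near=> y.
apply: le_lt_trans (hsum_norm_le ((l1, l2) - y)) _.
by rewrite (splitr e) ltrD //=; near: y.
Unshelve. all: by end_near. Qed.

HB.instance Definition _ := Uniform_isComplete.Build H hsum_complete.

Definition hsum_inner (x y : H) : R[i] := inner x.1 y.1 + inner x.2 y.2.

Lemma hsum_inner_bilinear :
  bilinear_for *%R (@Num.conj R[i] \; *%R) hsum_inner.
Proof.
split=> [y a u v|x a u v] /=; rewrite /hsum_inner /=.
  by rewrite !linearPl /= mulrDr addrACA.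
by rewrite !linearPr /= mulrDr addrACA.
Qed.

HB.instance Definition _ := bilinear_isBilinear.Build R[i] H H R[i]
  *%R (@Num.conj R[i] \; *%R) hsum_inner hsum_inner_bilinear.

Lemma hsum_inner_hermitian (x y : H) :
  hsum_inner x y = (-1) ^+ false * (hsum_inner y x)^*.
Proof. by rewrite /hsum_inner hermC [inner x.2 y.2]hermC !mul1r rmorphD. Qed.

HB.instance Definition _ := isHermitianSesquilinear.Build R[i] H false
  (@Num.conj R[i]) hsum_inner hsum_inner_hermitian.

Lemma hsum_inner_normE (x : H) : hsum_inner x x = `|x| ^+ 2.
Proof. by rewrite hsum_normE /hsum_inner !inner_normE. Qed.

Lemma hsum_inner_gt0 (x : H) : x != 0 -> 0 < hsum_inner x x.
Proof. by move=> x0; rewrite hsum_inner_normE exprn_gt0 // normr_gt0. Qed.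

HB.instance Definition _ := isDotProduct.Build R[i] H hsum_inner hsum_inner_gt0.

HB.instance Definition _ := CompleteNormedModule_isHilbert.Build R H
  hsum_inner_normE.

End HilbertSum.

(** * Unbounded linear operators *)

(* A linear operator from [U] to [V] with a domain that is a linear subspace
   of [U]; the values of the underlying function outside [op_dom] are
   irrelevant, and every notion below only depends on [op_graph]. *)
Record linop (K : nzRingType) (U V : lmodType K) := LinOp {
  op_dom : set U ;
  op_fun :> U -> V ;
  op_dom0 : op_dom 0 ;
  op_domP : forall a x y, op_dom x -> op_dom y -> op_dom (a *: x + y) ;
  op_linear : forall a x y, op_dom x -> op_dom y ->
    op_fun (a *: x + y) = a *: op_fun x + op_fun y
}.

Section AlgebraicNotions.
Variables (K : nzRingType) (U V : lmodType K).
Implicit Types T : linop U V.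

Definition op_graph T : set (U * V) := [set p | op_dom T p.1 /\ T p.1 = p.2].

Definition op_ker T : set U := [set x | op_dom T x /\ T x = 0].

Definition op_ran T : set V := T @` op_dom T.

(* The linear subspace [S] of [V] has finite dimension. *)
Definition finite_dim (S : set V) : Prop :=
  exists (n : nat) (e : 'I_n -> V), (forall i, S (e i)) /\
    forall v, S v -> exists c : 'I_n -> K, v = \sum_i c i *: e i.

(* The quotient of [V] by the linear subspace [S] has finite dimension. *)
Definition finite_codim (S : set V) : Prop :=
  exists (n : nat) (e : 'I_n -> V),
    forall v, exists c : 'I_n -> K, S (v - \sum_i c i *: e i).

Lemma op_fun0 T : T 0 = 0.
Proof.
have := op_linear (-1) (op_dom0 T) (op_dom0 T).
by rewrite scaler0 addr0 scaleN1r addNr.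
Qed.

End AlgebraicNotions.

Section Shift.
Variables (K : comNzRingType) (V : lmodType K) (T : linop V V) (l : K).

Lemma op_shift_linear a x y : op_dom T x -> op_dom T y ->
  T (a *: x + y) - l *: (a *: x + y) = a *: (T x - l *: x) + (T y - l *: y).
Proof.
move=> Tx Ty; rewrite op_linear // !scalerDr opprD scalerN !scalerA.
by rewrite [l * a]mulrC addrACA.
Qed.

(* The operator [T - l]. *)
Definition op_shift : linop V V :=
  LinOp (op_dom0 T) (@op_domP _ _ _ T) op_shift_linear.

End Shift.

Section Closure.
Variables (K : numFieldType) (U V : normedModType K).
Implicit Types T : linop U V.

Definition closable T : Prop :=
  forall v, closure (op_graph T) (0, v) -> v = 0.

Lemma closure_op_graphP T a (p q : U * V) :
  closure (op_graph T) p -> closure (op_graph T) q ->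
  closure (op_graph T) (a *: p + q).
Proof.
move=> cp cq B /= nB.
pose f (z : (U * V) * (U * V)) := a *: z.1 + z.2.
have cf : {for (p, q), continuous f}.
  apply: cvgD; last exact: cvg_snd.
  by apply: cvgZr; exact: cvg_fst.
have [[P Q] /= [nP nQ] PQ] := cf _ nB.
have [[x u] [[/= Tx <-] Px]] := cp _ nP.
have [[y v] [[/= Ty <-] Qy]] := cq _ nQ.
exists (a *: x + y, T (a *: x + y)); split.
  by split=> //=; exact: op_domP.
by rewrite op_linear //; apply: (PQ ((x, T x), (y, T y))).
Qed.

Definition closure_dom T : set U :=
  [set x | exists v, closure (op_graph T) (x, v)].

Definition closure_fun T (x : U) : V :=
  xget 0 [set v | closure (op_graph T) (x, v)].

Lemma closure_fun_graph T x :
  closure_dom T x -> closure (op_graph T) (x, closure_fun T x).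
Proof. by move=> [v cv]; rewrite /closure_fun; case: xgetP => [u ->|/(_ v)]. Qed.

Lemma closable_graph_inj T : closable T -> forall (x : U) (u v : V),
  closure (op_graph T) (x, u) -> closure (op_graph T) (x, v) -> u = v.
Proof.
move=> clT x u v cu cv; apply/eqP; rewrite -subr_eq0; apply/eqP/clT.
have := closure_op_graphP (a := -1) cv cu.
by rewrite [X in closure _ X](_ : _ = (0, u - v)) // scaleN1r; congr pair;
  rewrite /= addrC ?subrr.
Qed.

Lemma closure_dom0 T : closure_dom T 0.
Proof.
by exists 0; apply: subset_closure; split; [exact: op_dom0|exact: op_fun0].
Qed.

Lemma closure_domP T a x y :
  closure_dom T x -> closure_dom T y -> closure_dom T (a *: x + y).
Proof.
by move=> [u cu] [v cv]; exists (a *: u + v); exact: (closure_op_graphP (a := a) cu cv).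
Qed.

Lemma closure_fun_linear T (clT : closable T) a x y :
  closure_dom T x -> closure_dom T y ->
  closure_fun T (a *: x + y) = a *: closure_fun T x + closure_fun T y.
Proof.
move=> dx dy; apply: (closable_graph_inj clT).
  by apply: closure_fun_graph; exact: closure_domP.
exact: (closure_op_graphP (a := a) (closure_fun_graph dx) (closure_fun_graph dy)).
Qed.

(* The closure of a closable operator, characterized by [op_closure_graph]. *)
Definition op_closure T (clT : closable T) : linop U V :=
  LinOp (closure_dom0 T) (@closure_domP T) (closure_fun_linear clT).

Lemma op_closure_graph T (clT : closable T) :
  op_graph (op_closure clT) = closure (op_graph T).
Proof.
apply/seteqP; split=> [[x v] [/= dx <-]|[x v] cv]; first exact: closure_fun_graph.
have dx : closure_dom T x by exists v.
by split=> //=; exact: (closable_graph_inj clT (closure_fun_graph dx) cv).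
Qed.

End Closure.

(** * Resolvent set and essential spectra *)

Section Spectra.
Variables (K : numFieldType) (V : normedModType K) (T : linop V V).

(* [T - l] is a bijection from its domain onto [V] with bounded inverse. *)
Definition resolvent_set : set K :=
  [set l | set_bij (op_dom T) setT (op_shift T l) /\
    exists M : K, forall x, op_dom T x -> `|x| <= M * `|op_shift T l x| ].

Definition sigma_e2 : set K :=
  [set l | ~ (closed (op_ran (op_shift T l)) /\
              finite_dim (op_ker (op_shift T l)))].

Definition sigma_e2_star : set K :=
  [set l | ~ (closed (op_ran (op_shift T l)) /\
              finite_codim (op_ran (op_shift T l)))].

End Spectra.

(** * Lower triangular operator matrices *)

Section LowerTriangular.
Variables (R : realType) (H1 H2 : hilbertType R).
Variables (A : linop H1 H1) (C : linop H1 H2) (D : linop H2 H2).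
Hypothesis domAC : op_dom A `<=` op_dom C.

Definition tri_dom : set (hsum H1 H2) :=
  [set x | op_dom A x.1 /\ op_dom D x.2].

Definition tri_fun (x : hsum H1 H2) : hsum H1 H2 := (A x.1, C x.1 + D x.2).

Lemma tri_dom0 : tri_dom 0.
Proof. by split; exact: op_dom0. Qed.

Lemma tri_domP a x y : tri_dom x -> tri_dom y -> tri_dom (a *: x + y).
Proof. by move=> [? ?] [? ?]; split; exact: op_domP. Qed.

Lemma tri_fun_linear a x y : tri_dom x -> tri_dom y ->
  tri_fun (a *: x + y) = a *: tri_fun x + tri_fun y.
Proof.
move=> [x1 x2] [y1 y2]; rewrite /tri_fun /= !op_linear //; try exact: domAC.
by congr pair; rewrite /= scalerDr addrACA.
Qed.

Definition lower_tri : linop (hsum H1 H2) (hsum H1 H2) :=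
  LinOp tri_dom0 tri_domP tri_fun_linear.

End LowerTriangular.

Arguments lower_tri {R H1 H2 A C} D domAC.

(* Main.v *)
Require Import Defs.
From HB Require Import structures.
From mathcomp Require Import all_boot all_order all_algebra.
From mathcomp Require Import sesquilinear complex ring lra.
From mathcomp Require Import boolp classical_sets functions reals.
From mathcomp Require Import topology normedtype.

(** For a closed operator [T] between Hilbert spaces, having closed range and
    finite-dimensional kernel amounts to being bounded below on some linear
    subspace of finite codimension in [op_dom T] ([cofinitely_bounded_belowP]).
    The subspace need not be closed, so finite codimension is pure algebra: it
    passes to preimages and images under linear maps and is transitive, and
    this is all that is needed to move the property between operators.

    With [T] the operator matrix minus [l], and [D] standing for its closure:
    - if [A - l] and [D - l] are bounded below on [S1] and [S2], then [T] is
      bounded below on [S1 x S2], because [C] is bounded relatively to [A]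
      ([tri_bounded_below_diag]);
    - if [T] is bounded below on [S], then [D - l] is bounded below on the slice
      of [S] over [x = 0], on which [T] acts as [D - l]
      ([tri_bounded_below_snd]);
    - if moreover the range of [D - l] has finite codimension, then for all [x]
      in a subspace of finite codimension of [op_dom A] there is a [y] such that
      [(x, y)] is in [S] and [T (x, y) = ((A - l) x, 0)], whence
      [|x| <= |(x, y)| <= c |(A - l) x|]; no bound on [y] is involved
      ([tri_bounded_below_fst]).
    The three inclusions between the spectra are the contrapositives.

    Two facts from functional analysis enter. The open mapping theorem, for
    closed linear relations with closed range ([bounded_lifting]), gives both
    the lower bound for an operator with closed range and the relative
    boundedness of [C] ([relatively_bounded]). Conversely, closedness of the
    range follows from a lower bound on a subspace of finite codimension because
    adding finitely many vectors to a closed subspace keeps it closed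
    ([closure_add_span]). Relative boundedness of [C] also shows that the
    closure of the matrix is the matrix with [D] replaced by its closure
    ([graph_closure_tri]), so that the argument may be run with [D] closed. *)

Set Implicit Arguments.
Unset Strict Implicit.
Unset Printing Implicit Defensive.

Import Order.TTheory GRing.Theory Num.Theory.
Import numFieldNormedType.Exports.

Local Open Scope classical_set_scope.
Local Open Scope ring_scope.

(** * Subspaces of finite codimension *)

Section FiniteCodimension.
Variable K : fieldType.

Definition lin_subspace (V : lmodType K) (S : set V) : Prop :=
  S 0 /\ forall a x y, S x -> S y -> S (a *: x + y).

Definition linear_on (U V : lmodType K) (X : set U) (L : U -> V) : Prop :=
  forall a x y, X x -> X y -> L (a *: x + y) = a *: L x + L y.

(** The complementary vectors are required to lie in [X], so that images under
    maps that are linear on [X] only can be taken. *)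
Definition cofinite_in (V : lmodType K) (X S : set V) : Prop :=
  exists (n : nat) (e : 'I_n -> V), (forall i, X (e i)) /\
    forall x, X x -> exists c : 'I_n -> K, S (x - \sum_i c i *: e i).

Section Subspace.
Variables (V : lmodType K) (S : set V).
Hypothesis subS : lin_subspace S.

Lemma lin_subspaceZ a x : S x -> S (a *: x).
Proof. by move=> Sx; rewrite -[a *: x]addr0; apply: subS.2 => //; case: subS. Qed.

Lemma lin_subspaceD x y : S x -> S y -> S (x + y).
Proof. by move=> Sx Sy; rewrite -[x]scale1r; exact: subS.2. Qed.

Lemma lin_subspaceB x y : S x -> S y -> S (x - y).
Proof. by move=> Sx Sy; rewrite addrC -scaleN1r; exact: subS.2. Qed.

Lemma lin_subspace_sum n (c : 'I_n -> K) (e : 'I_n -> V) :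
  (forall i, S (e i)) -> S (\sum_i c i *: e i).
Proof.
by move=> Se; elim/big_ind: _ => [||i _]; [case: subS|exact: lin_subspaceD|
  exact: lin_subspaceZ].
Qed.

End Subspace.

Section LinearOn.
Variables (U V : lmodType K) (X : set U) (L : U -> V).
Hypotheses (subX : lin_subspace X) (linL : linear_on X L).

Lemma linear_on0 : L 0 = 0.
Proof.
have := linL (-1) subX.1 subX.1.
by rewrite scaler0 addr0 scaleN1r addNr.
Qed.

Lemma linear_onB x y : X x -> X y -> L (x - y) = L x - L y.
Proof. by move=> Xx Xy; rewrite addrC -scaleN1r linL // scaleN1r addrC. Qed.

Lemma linear_on_sum n (c : 'I_n -> K) (e : 'I_n -> U) :
  (forall i, X (e i)) -> L (\sum_i c i *: e i) = \sum_i c i *: L (e i).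
Proof.
elim: n c e => [|n IHn] c e Xe; first by rewrite !big_ord0 linear_on0.
rewrite !big_ord_recl linL ?IHn //.
by apply: lin_subspace_sum.
Qed.

Lemma lin_subspace_image : lin_subspace (L @` X).
Proof.
split; first by exists 0; [exact: subX.1|exact: linear_on0].
by move=> a _ _ [x Xx <-] [y Xy <-]; exists (a *: x + y); [exact: subX.2|exact: linL].
Qed.

Lemma lin_subspace_preimage (S : set V) : lin_subspace S -> lin_subspace (X `&` L @^-1` S).
Proof.
move=> subS; split; first by split; [exact: subX.1|rewrite /preimage /= linear_on0; exact: subS.1].
move=> a x y [Xx Sx] [Xy Sy]; split; first exact: subX.2.
by rewrite /preimage /= linL //; exact: subS.2.
Qed.

Lemma cofinite_in_image (S : set U) :
  S `<=` X -> cofinite_in X S -> cofinite_in (L @` X) (L @` S).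
Proof.
move=> SX [n [e [Xe Se]]]; exists n, (L \o e); split=> [i|_ [x Xx <-]].
  by exists (e i).
have [c Sc] := Se x Xx; exists c, (x - \sum_i c i *: e i) => //.
by rewrite linear_onB ?linear_on_sum //; apply: lin_subspace_sum.
Qed.

End LinearOn.

Lemma cofinite_in_trans (V : lmodType K) (X Y Z : set V) :
  Y `<=` X -> cofinite_in X Y -> cofinite_in Y Z -> cofinite_in X Z.
Proof.
move=> YX [n [e [Xe Ye]]] [m [f [Yf Zf]]].
exists (n + m)%N,
  (fun i : 'I_(n + m) => match fintype.split i with inl j => e j | inr k => f k end).
split=> [i|x Xx]; first by case: (fintype.split i) => j //; exact: YX.
have [c Yc] := Ye x Xx; have [d Zd] := Zf _ Yc.
exists (fun i : 'I_(n + m) => match fintype.split i with inl j => c j | inr k => d k end).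
rewrite big_split_ord /=.
rewrite (eq_bigr (fun i => c i *: e i)); last first.
  by move=> i _; rewrite (unsplitK (inl i)).
rewrite [X in _ - (_ + X)](eq_bigr (fun i => d i *: f i)); last first.
  by move=> i _; rewrite (unsplitK (inr i)).
by rewrite opprD addrA.
Qed.

Lemma lin_subspace_add_line (V : lmodType K) (S : set V) e :
  lin_subspace S -> lin_subspace [set w | exists a, S (w - a *: e)].
Proof.
move=> subS; split; first by exists 0; rewrite scale0r subr0; exact: subS.1.
move=> a x y [b Sx] [c Sy]; exists (a * b + c).
have -> : a *: x + y - (a * b + c) *: e = a *: (x - b *: e) + (y - c *: e).
  by rewrite scalerBr scalerDl -scalerA opprD addrACA.
exact: subS.2.
Qed.

(** Since the vectors [e i] need not lie in the image of [L], this also yields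
    finite codimension of intersections ([L] the identity) and of common kernels
    of finitely many functionals ([S] reduced to 0). By induction it is enough
    to compare the preimages of [S] and of [S] plus one line: they agree or
    differ by one vector [y0]. *)
Lemma cofinite_in_preimage (U V : lmodType K) (X : set U) (L : U -> V)
    (S : set V) n (e : 'I_n -> V) :
  lin_subspace X -> linear_on X L -> lin_subspace S ->
  (forall x, X x -> exists c : 'I_n -> K, S (L x - \sum_i c i *: e i)) ->
  cofinite_in X (X `&` L @^-1` S).
Proof.
move=> subX linL; elim: n e S => [|n IHn] e S subS Se.
  exists 0, (fun=> 0); split=> [[]//|x Xx]; exists (fun=> 0).
  have [c] := Se x Xx; rewrite !big_ord0 !subr0 => Sx.
  by split.
set e0 := e ord0.
pose S' := [set w | exists a, S (w - a *: e0)].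
have subS' : lin_subspace S' by exact: lin_subspace_add_line.
have := IHn (e \o lift ord0) S' subS'; set X' := X `&` _ => cofX.
apply: (@cofinite_in_trans _ _ X') => [x []//||].
  apply: cofX => x Xx; have [c Sc] := Se x Xx.
  exists (c \o lift ord0); exists (c ord0).
  by move: Sc; rewrite big_ord_recl opprD addrA addrAC.
have [[y0 [a [Xy0 a0 Sy0]]]|none] :=
    pselect (exists y a, [/\ X y, a != 0 & S (L y - a *: e0)]).
  exists 1, (fun=> y0); split=> [_|y [Xy [b Sb]]]; first by split=> //; exists a.
  exists (fun=> b / a); rewrite big_ord1; split.
    by apply: lin_subspaceB => //; exact: lin_subspaceZ.
  rewrite /preimage /= addrC -scaleNr linL //.
  have -> : - (b / a) *: L y0 + L y =
      - (b / a) *: (L y0 - a *: e0) + (L y - b *: e0).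
    rewrite scalerBr scalerA mulNr divfK // [(- b) *: _]scaleNr opprK.
    by rewrite addrA [RHS]addrAC addrK.
  exact: subS.2.
exists 0, (fun=> 0); split=> [[]//|y [Xy [b Sb]]]; exists (fun=> 0).
rewrite big_ord0 subr0; split=> //.
have [b0|b0] := eqVneq b 0; first by move: Sb; rewrite b0 scale0r subr0.
by case: none; exists y, b.
Qed.

End FiniteCodimension.

(** * Real-valued norms and closures *)

Section RealNorm.
Variable R : realType.

(** Norms over [R[i]] take their values in [R[i]], whose order is only partial;
    their real parts carry the same information and are open to linear
    arithmetic. *)
Definition cabs (a : R[i]) : R := complex.Re `|a|.

Definition rnorm (V : normedModType R[i]) (x : V) : R := complex.Re `|x|.

Lemma cabsE (a : R[i]) : `|a| = (cabs a)%:C%C.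
Proof. by rewrite /cabs RRe_real ?normr_real. Qed.

Lemma cabs_ge0 (a : R[i]) : 0 <= cabs a.
Proof. by rewrite -ler0c -cabsE. Qed.

Lemma cabs_real (r : R) : 0 <= r -> cabs r%:C%C = r.
Proof. by move=> r0; apply: complexI; rewrite -cabsE ger0_norm // ler0c. Qed.

Variable V : normedModType R[i].
Implicit Types x y z : V.

Lemma rnormE x : `|x| = (rnorm x)%:C%C.
Proof. by rewrite /rnorm RRe_real ?normr_real. Qed.

Lemma rnorm_ge0 x : 0 <= rnorm x.
Proof. by rewrite -ler0c -rnormE. Qed.

Lemma rnorm0 : rnorm (0 : V) = 0.
Proof. by rewrite /rnorm normr0. Qed.

Lemma rnorm0_eq0 x : rnorm x = 0 -> x = 0.
Proof. by move=> x0; apply: normr0_eq0; rewrite rnormE x0. Qed.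

Lemma rnormZ (a : R[i]) x : rnorm (a *: x) = cabs a * rnorm x.
Proof. by apply: complexI; rewrite -rnormE normrZ cabsE rnormE rmorphM. Qed.

Lemma rnormN x : rnorm (- x) = rnorm x.
Proof. by rewrite /rnorm normrN. Qed.

Lemma rnormBC x y : rnorm (x - y) = rnorm (y - x).
Proof. by rewrite -rnormN opprB. Qed.

Lemma rnormD x y : rnorm (x + y) <= rnorm x + rnorm y.
Proof. by rewrite -lecR rmorphD /= -!rnormE ler_normD. Qed.

Lemma rnormB x y : rnorm (x - y) <= rnorm x + rnorm y.
Proof. by rewrite -(rnormN y) rnormD. Qed.

Lemma rnorm_dist y x z : rnorm (x - z) <= rnorm (x - y) + rnorm (y - z).
Proof. by have := rnormD (x - y) (y - z); rewrite addrA addrNK. Qed.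

Lemma nbhs_rnormP x (B : set V) :
  nbhs x B <-> exists2 e : R, 0 < e & forall y, rnorm (x - y) < e -> B y.
Proof.
rewrite -(filter_from_norm_nbhs x); split=> [[e /= e0 eB]|[e e0 eB]].
  have eE : (complex.Re e)%:C%C = e by rewrite RRe_real // gtr0_real.
  exists (complex.Re e); first by rewrite -ltcR eE.
  by move=> y xy; apply: eB; rewrite /ball_ /= rnormE -eE ltcR.
exists e%:C%C; first by rewrite /= ltcR.
by move=> y; rewrite /ball_ /= rnormE ltcR => /eB.
Qed.

Lemma closure_rnormP (B : set V) x :
  closure B x <-> forall e : R, 0 < e -> exists2 y, B y & rnorm (x - y) < e.
Proof.
split=> [cBx e e0|Bx A /nbhs_rnormP[e e0 eA]].
  have [|y [By xy]] := cBx [set y | rnorm (x - y) < e]; last by exists y.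
  by apply/nbhs_rnormP; exists e.
by have [y By /eA Ay] := Bx e e0; exists y.
Qed.

End RealNorm.

Lemma closure_prod_rnormP (R : realType) (U V : normedModType R[i])
    (B : set (U * V)) u v :
  closure B (u, v) <-> forall e : R, 0 < e ->
    exists x y, [/\ B (x, y), rnorm (u - x) < e & rnorm (v - y) < e].
Proof.
split=> [cB e e0|Buv A [[P Q] [/= /nbhs_rnormP[e e0 eP] /nbhs_rnormP[d d0 dQ]] PQA]].
  have [|[x y] [Bxy [/= ux vy]]] :=
      cB ([set x | rnorm (u - x) < e] `*` [set y | rnorm (v - y) < e]).
    by exists ([set x | rnorm (u - x) < e], [set y | rnorm (v - y) < e]);
      [split; apply/nbhs_rnormP; exists e|].
  by exists x, y.
have m0 : 0 < Num.min e d by rewrite lt_min e0.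
have [x [y []]] := Buv _ m0; rewrite !lt_min => Bxy /andP[/eP Px _] /andP[_ /dQ Qy].
by exists (x, y); split=> //; apply: PQA.
Qed.

Lemma le_all_eps (R : realType) (a b : R) :
  (forall e, 0 < e -> a <= b + e) -> a <= b.
Proof. by move=> ab; apply/ler_addgt0Pr. Qed.

Lemma eq0_small (R : realType) (V : normedModType R[i]) (k : R) (x : V) :
  (forall e, 0 < e -> rnorm x <= k * e) -> x = 0.
Proof.
move=> xk; apply: rnorm0_eq0; apply/eqP; rewrite eq_le rnorm_ge0 andbT.
apply: le_all_eps => e e0; rewrite add0r.
have k0 : 0 < `|k| + 1 by rewrite ltr_wpDl.
apply: le_trans (xk (e / (`|k| + 1)) _) _; first by rewrite divr_gt0.
rewrite mulrA ler_pdivrMr // mulrC ler_pM2l //.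
by apply: (le_trans (ler_norm k)); rewrite lerDl.
Qed.

(** * Sequences with geometrically decreasing steps *)

Lemma halving_le (R : realType) (r : nat -> R) :
  (forall k, r k.+1 <= r k / 2) -> forall k, r k <= r 0%N / 2 ^+ k.
Proof.
move=> rS; elim=> [|k IHk]; first by rewrite expr0 divr1.
apply: le_trans (rS k) _.
by rewrite exprSr invfM mulrA ler_pM2r // invr_gt0.
Qed.

Lemma halving_small (R : realType) (r : nat -> R) :
  (forall k, r k.+1 <= r k / 2) -> forall e, 0 < e -> exists k, r k < e.
Proof.
move=> rS e e0; exists (Num.bound (r 0%N / e)).
apply: le_lt_trans (halving_le rS _) _.
by rewrite ltr_pdivrMr ?exprn_gt0 // mulrC -ltr_pdivrMr // upper_nthrootP.
Qed.

(** Halving steps form a geometric series, so completeness applies and the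
    distance to the limit is explicit. *)
Lemma cvg_halving (R : realType) (V : completeNormedModType R[i])
    (x : nat -> V) (r : nat -> R) :
  (forall k, rnorm (x k.+1 - x k) <= r k) -> (forall k, r k.+1 <= r k / 2) ->
  exists l, forall k, rnorm (l - x k) <= 2 * r k.
Proof.
move=> xr rS.
have r_ge0 k : 0 <= r k by apply: le_trans (xr k); exact: rnorm_ge0.
have tail k j : rnorm (x (k + j)%N - x k) + 2 * r (k + j)%N <= 2 * r k.
  elim: j => [|j IHj]; first by rewrite addn0 subrr rnorm0 add0r.
  have := rnorm_dist (x (k + j)%N) (x (k + j.+1)%N) (x k).
  by have := rS (k + j)%N; have := xr (k + j)%N; rewrite addnS; lra.
have tail' k m : (k <= m)%N -> rnorm (x m - x k) <= 2 * r k.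
  by move=> km; have := tail k (m - k)%N; rewrite subnKC //; have := r_ge0 m; lra.
have : cvg (x @ \oo).
  apply: cauchy_cvg; apply: cauchy_exP => e e0.
  have eE : (complex.Re e)%:C%C = e by rewrite RRe_real // gtr0_real.
  have e20 : 0 < complex.Re e / 2 by rewrite divr_gt0 // -ltcR eE.
  have [k rk] := halving_small rS e20.
  exists (x k); exists k => // m /= km.
  rewrite -ball_normE /ball_ /= rnormE -eE ltcR rnormBC.
  by apply: le_lt_trans (tail' _ _ km) _; lra.
move=> /cvg_ex[l xl]; exists l => k; apply: le_all_eps => e e0.
have /xl [N _ Nx] : nbhs l [set y | rnorm (l - y) < e] by apply/nbhs_rnormP; exists e.
have := Nx (maxn N k) (leq_maxl _ _); rewrite /=.
have := tail' _ _ (leq_maxr N k).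
by have := rnorm_dist (x (maxn N k)) l (x k); lra.
Qed.

(** * The open mapping theorem for closed linear relations *)

Section OpenMapping.
Variable R : realType.

(** Baire category theorem relative to a closed subset [E]. If no closure of a
    [B n] contained a ball of [E], one could choose nested balls with centres in
    [E], the ball number [n + 1] missing [B n]; their common point would lie in
    [E] but in no [B n]. *)
Lemma closed_cover_interior (V : completeNormedModType R[i]) (E : set V)
    (B : nat -> set V) :
  E !=set0 -> closure E `<=` E -> E `<=` \bigcup_n B n ->
  exists n v (r : R), [/\ 0 < r, E v &
    forall w, E w -> rnorm (w - v) < r -> closure (B n) w].
Proof.
move=> [v0 Ev0] clE EB; apply: contrapT => noball.
have step (np : nat * (V * R)) : exists q : V * R, E np.2.1 -> 0 < np.2.2 ->
    [/\ E q.1, 0 < q.2, q.2 <= np.2.2 / 2, rnorm (q.1 - np.2.1) <= np.2.2 &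
        forall z, B np.1 z -> 2 * q.2 < rnorm (z - q.1)].
  case: np => n [v r] /=.
  have [[Ev r0]|] := pselect (E v /\ 0 < r); last by exists (v, r) => ? ?; exfalso; auto.
  apply: contrapT => noq; apply: noball; exists n, v, r; split=> // w Ew wv.
  apply/closure_rnormP => e e0; apply: contrapT => noz; apply: noq.
  (* A point of [B n] within [2 * m] of [w] would be within [e] of [w]. *)
  pose m := Num.min (r / 2) (e / 3).
  have m0 : 0 < m by rewrite lt_min !divr_gt0.
  have [mr me] : m <= r / 2 /\ m <= e / 3 by rewrite !ge_min !lexx orbT.
  exists (w, m) => _ _; split=> //=; first exact: ltW.
  move=> z Bz; rewrite ltNge; apply/negP => zw; apply: noz; exists z => //.
  by rewrite rnormBC; lra.
have [F FP] := choice step.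
pose s := fix s k := if k is k.+1 then F (k, s k) else (v0, 1).
have sP k : E (s k).1 /\ 0 < (s k).2.
  by elim: k => [|k [Es s0]] //; have /= [] := FP (k, s k) Es s0.
have sF k := FP (k, s k) (sP k).1 (sP k).2.
have sS k : (s k.+1).2 <= (s k).2 / 2 by have /= [] := sF k.
have [l lx] : exists l, forall k, rnorm (l - (s k).1) <= 2 * (s k).2.
  by apply: cvg_halving sS => k; have /= [] := sF k.
(* Centre number [n + 1] is farther than twice its radius from [B n], whereas
   the limit of the centres is within twice that radius. *)
have [n _ Bnl] : (\bigcup_n B n) l.
  apply: EB; apply: clE; apply/closure_rnormP => e e0.
  have [k sk] := halving_small sS (divr_gt0 e0 (ltr0n R 2)).
  by exists (s k).1; [case: (sP k)|have := lx k; lra].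
have /= [_ _ _ _ /(_ l Bnl)] := sF n.
by have := lx n.+1; rewrite /=; lra.
Qed.

Variables (U V : completeNormedModType R[i]) (G : set (U * V)).
Hypotheses (subG : lin_subspace G) (clG : closure G `<=` G).
Hypothesis clR : closure (snd @` G) `<=` snd @` G.

Let rel0 : G (0, 0). Proof. exact: subG.1. Qed.

Let relP a x y u v : G (x, y) -> G (u, v) -> G (a *: x + u, a *: y + v).
Proof. exact: subG.2. Qed.

Let relB x y u v : G (x, y) -> G (u, v) -> G (x - u, y - v).
Proof. by move=> Gx Gu; have := relP (-1) Gu Gx; rewrite !scaleN1r ![- _ + _]addrC. Qed.

Let relZ a x y : G (x, y) -> G (a *: x, a *: y).
Proof. by move=> Gx; have := relP a Gx rel0; rewrite !addr0. Qed.

(** The closure of the image of some ball contains a relative ball, of centre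
    [v0] and radius [r]; subtracting the centre and scaling gives approximate
    preimages with a uniform bound for all [v]. *)
Lemma approximate_lifting : exists2 c : R, 0 <= c &
  forall v, (snd @` G) v -> forall e : R, 0 < e ->
    exists u w, [/\ G (u, w), rnorm u <= c * rnorm v & rnorm (v - w) < e].
Proof.
pose B n := [set v | exists2 u, G (u, v) & rnorm u <= n%:R].
have [||n [v0 [r [r0 [[u0 w0] Guw0 /= w0v0] Bn]]]] :=
    closed_cover_interior (E := snd @` G) (B := B) _ clR.
- by exists 0; exists (0, 0).
- move=> _ [[u v] Guv <-] /=; exists (Num.bound (rnorm u)) => //; exists u => //.
  by apply: ltW; exact: archi_boundP (rnorm_ge0 u).
rewrite {}w0v0 in Guw0.
have n0 : 0 <= n%:R :> R by [].
exists (4 * n%:R / r); first by rewrite divr_ge0 ?mulr_ge0 // ltW.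
move=> v [[u1 v1] Guv /= v1v] e e0; rewrite {}v1v in Guv.
have [v_0|v_neq0] := eqVneq (rnorm v) 0.
  by exists 0, 0; rewrite v_0 mulr0 rnorm0 subr0 v_0.
have v_gt0 : 0 < rnorm v by rewrite lt_def v_neq0 rnorm_ge0.
(* Scaling by [t] brings [v] into the ball of radius [r]. *)
set t := r / (2 * rnorm v).
have t0 : 0 < t by rewrite divr_gt0 // mulr_gt0.
have tC0 : t%:C%C != 0 :> R[i] by rewrite gt_eqF // ltcR.
have et0 : 0 < e * t / 2 by rewrite divr_gt0 // mulr_gt0.
have /closure_rnormP/(_ _ et0)[w1 [x1 Gxw1 x1n] vw1] : closure (B n) (t%:C%C *: v + v0).
  apply: Bn; first by exists (t%:C%C *: u1 + u0, t%:C%C *: v + v0) => //; exact: relP.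
  rewrite addrK rnormZ cabs_real; last exact: ltW.
  have -> : t * rnorm v = r / 2 by rewrite /t; field.
  by lra.
have /closure_rnormP/(_ _ et0)[w2 [x2 Gxw2 x2n] vw2] : closure (B n) v0.
  by apply: Bn; [exists (u0, v0)|rewrite subrr rnorm0].
have tV : cabs (t%:C%C)^-1 = t^-1 by rewrite -fmorphV cabs_real // invr_ge0 ltW.
exists ((t%:C%C)^-1 *: (x1 - x2)), ((t%:C%C)^-1 *: (w1 - w2)); split.
- by apply: relZ; exact: relB.
- rewrite rnormZ tV mulrC ler_pdivrMr //.
  have -> : 4 * n%:R / r * rnorm v * t = 2 * n%:R.
    by rewrite /t; field; rewrite v_neq0 gt_eqF.
  by have := rnormB x1 x2; lra.
- have -> : v - (t%:C%C)^-1 *: (w1 - w2) =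
      (t%:C%C)^-1 *: ((t%:C%C *: v + v0 - w1) - (v0 - w2)).
    rewrite !opprB addrAC addrACA subrr addr0 -addrA -[w2 - w1]opprB [RHS]scalerBr.
    by rewrite scalerA mulVf // scale1r.
  rewrite rnormZ tV mulrC ltr_pdivrMr //.
  by have := rnormB (t%:C%C *: v + v0 - w1) (v0 - w2); lra.
Qed.

(** Open mapping theorem for the closed linear relation [G]: approximating [v]
    up to half its norm and iterating on the error gives a preimage of [v] as a
    geometric series. *)
Lemma bounded_lifting : exists2 c : R, 0 <= c &
  forall v, (snd @` G) v -> exists2 u, G (u, v) & rnorm u <= c * rnorm v.
Proof.
have [c c0 approx] := approximate_lifting; exists (2 * c); first by rewrite mulr_ge0.
have step v : exists p : U * V, (snd @` G) v ->
    [/\ G p, rnorm p.1 <= c * rnorm v & rnorm (v - p.2) <= rnorm v / 2].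
  have [Rv|nRv] := pselect ((snd @` G) v); last by exists (0, 0) => /nRv.
  have [v_0|v_neq0] := eqVneq (rnorm v) 0.
    by exists (0, 0) => _; rewrite /= v_0 mul0r mulr0 rnorm0 subr0 v_0.
  have [|u [w [Guw uv vw]]] := approx v Rv (rnorm v / 2).
    by rewrite divr_gt0 // lt_def v_neq0 rnorm_ge0.
  by exists (u, w) => _; split=> //; exact: ltW.
have [F FP] := choice step.
move=> v Rv.
(* The partial sum of the preimages, paired with the current error. *)
pose s := fix s k : U * V := if k is k.+1
  then ((s k).1 + (F (s k).2).1, (s k).2 - (F (s k).2).2) else (0, v).
have sP k : (snd @` G) (s k).2 /\ G ((s k).1, v - (s k).2).
  elim: k => [|k [Rs Gs]] /=; first by rewrite subrr.
  have [] := FP _ Rs; case: (F (s k).2) => p q /= Gpq _ _; split.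
    by case: Rs => -[x y] Gxy /= <-; exists (x - p, y - q) => //; exact: relB.
  have := relP 1 Gs Gpq; rewrite !scale1r.
  by rewrite opprB [q - _]addrC addrA.
have sF k := FP _ (sP k).1.
have r2 k : rnorm (s k.+1).2 <= rnorm (s k).2 / 2 by have /= [] := sF k.
have [||l lx] := @cvg_halving _ _ (fun k => (s k).1) (fun k => c * rnorm (s k).2).
- by move=> k /=; rewrite addrC addKr; have [] := sF k.
- by move=> k; rewrite -mulrA ler_wpM2l.
exists l; last by have := lx 0%N; rewrite /= subr0 mulrA.
apply: clG; apply/closure_prod_rnormP => e e0.
have [||k sk] := @halving_small _ (fun k => (2 * c + 1) * rnorm (s k).2) _ e => //.
  by move=> k; rewrite -mulrA ler_wpM2l // addr_ge0 // mulr_ge0.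
have := lx k; have := rnorm_ge0 (s k).2; have cs := mulr_ge0 c0 (rnorm_ge0 (s k).2) => s0 lk.
exists (s k).1, (v - (s k).2); split; [by have [] := sP k|by lra|].
by rewrite opprB addrC addrNK; lra.
Qed.

End OpenMapping.

(** * Adding finitely many vectors to a closed subspace *)

Section FiniteExtension.
Variables (R : realType) (V : hilbertType R).

Lemma innerDl (x y z : V) : inner (x + y) z = inner x z + inner y z.
Proof. exact: linearDl. Qed.

Lemma innerDr (x y z : V) : inner x (y + z) = inner x y + inner x z.
Proof. exact: linearDr. Qed.

Lemma innerBl (x y z : V) : inner (x - y) z = inner x z - inner y z.
Proof. exact: linearBl. Qed.

Lemma innerZl a (x z : V) : inner (a *: x) z = a * inner x z.
Proof. exact: linearZl. Qed.

Lemma innerZr a (x z : V) : inner x (a *: z) = a^* * inner x z.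
Proof. exact: linearZr. Qed.

Lemma rnorm_orthogonal (x y : V) : inner x y = 0 -> rnorm x <= rnorm (x + y).
Proof.
move=> xy; have yx : inner y x = 0.
  have -> : inner y x = (-1) ^+ false * (inner x y)^* by exact: hermC.
  by rewrite xy rmorph0 mulr0.
rewrite -lecR -!rnormE -(@ler_pXn2r _ 2) ?nnegrE // -!inner_normE.
have -> : inner (x + y) (x + y) = inner x x + inner y y.
  by rewrite innerDl !innerDr xy yx addr0 add0r.
by rewrite lerDl inner_normE exprn_ge0.
Qed.

(** If [w] is a limit of multiples of [e], so is it of its orthogonal projection
    on the line of [e], which is closer to [w] than any other multiple. *)
Lemma closure_line (e w : V) :
  closure [set a *: e | a in [set: R[i]]] w -> exists a, w = a *: e.
Proof.
move=> /closure_rnormP cw.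
have [e0|e0] := eqVneq e 0.
  exists 0; rewrite scale0r; apply: (@eq0_small _ _ 1) => d d0.
  have [_ [a _ <-]] := cw d d0.
  by rewrite e0 scaler0 subr0 mul1r => /ltW.
have ee0 : inner e e != 0 by rewrite inner_normE expf_neq0 // normr_eq0.
exists (inner w e / inner e e); set a := _ / _.
apply/eqP; rewrite -subr_eq0; apply/eqP.
apply: (@eq0_small _ _ 1) => d d0; rewrite mul1r.
have [_ [b _ <-] wb] := cw d d0.
apply: le_trans (ltW wb).
have -> : w - b *: e = (w - a *: e) + (a - b) *: e.
  by rewrite scalerBl addrA addrNK.
apply: rnorm_orthogonal.
by rewrite innerZr innerBl innerZl /a divfK // subrr mulr0.
Qed.

(** Either [e] is a limit of points of [S] and adding it does not change the
    closure, or [e] has a positive distance [d] from [S]; then the coefficient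
    [a] of [e] in [s + a *: e] is controlled by the norm, so it converges along
    any convergent sequence. *)
Lemma closure_add_line (S : set V) (e z : V) : lin_subspace S ->
  closure [set w | exists a, S (w - a *: e)] z -> exists a, closure S (z - a *: e).
Proof.
move=> subS /closure_rnormP cz.
have [/closure_rnormP cSe|ncSe] := pselect (closure S e).
  exists 0; rewrite scale0r subr0; apply/closure_rnormP => d d0.
  have [x [a Sx] zx] := cz _ (divr_gt0 d0 (ltr0n R 2)).
  have a1 : 0 < cabs a + 1 by rewrite ltr_wpDl // cabs_ge0.
  have [s Ss es] := cSe (d / 2 / (cabs a + 1)) (divr_gt0 (divr_gt0 d0 (ltr0n R 2)) a1).
  exists (x - a *: e + a *: s).
    by rewrite addrC; exact: subS.2.
  have -> : z - (x - a *: e + a *: s) = (z - x) + a *: (e - s).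
    by rewrite scalerBr !opprD opprK !addrA.
  apply: le_lt_trans (rnormD _ _) _; rewrite rnormZ.
  have : cabs a * rnorm (e - s) <= d / 2.
    move: es; rewrite ltr_pdivlMr // => es.
    have := rnorm_ge0 (e - s); lra.
  by lra.
have [d d0 dS] : exists2 d : R, 0 < d & forall s, S s -> d <= rnorm (e - s).
  apply: contrapT => nod; apply: ncSe; apply/closure_rnormP => d d0.
  apply: contrapT => nos; apply: nod; exists d => // s Ss.
  by rewrite leNgt; apply/negP => es; apply: nos; exists s.
have aS a s : S s -> cabs a * d <= rnorm (s + a *: e).
  move=> Ss; have [->|a0] := eqVneq a 0.
    by rewrite /cabs normr0 mul0r rnorm_ge0.
  have -> : s + a *: e = a *: (e - (- a^-1) *: s).
    by rewrite scaleNr opprK scalerDr scalerA mulfV // scale1r addrC.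
  rewrite rnormZ ler_wpM2l ?cabs_ge0 //; apply: dS.
  exact: lin_subspaceZ.
(* Points [(f k).1] of the sum converging to [z], with coefficients [(f k).2]. *)
have pick k : exists p : V * R[i], S (p.1 - p.2 *: e) /\ rnorm (z - p.1) < 2^-1 ^+ k.
  have k0 : 0 < (2^-1 : R) ^+ k by rewrite exprn_gt0 // invr_gt0.
  by have [x [a Sx] zx] := cz _ k0; exists (x, a).
have [f fP] := choice pick.
have fS k : rnorm (z - (f k.+1).1) < 2^-1 ^+ k.
  have [_ zf] := fP k.+1; apply: lt_le_trans zf _.
  by rewrite exprS ler_piMl ?exprn_ge0 // ?invr_ge0 // invf_le1 // ler1n.
pose r k := 2 / d * rnorm e * 2^-1 ^+ k.
have [||w wP] := @cvg_halving R V (fun k => (f k).2 *: e) r.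
- move=> k; rewrite -scalerBl rnormZ /r.
  have [Sk zk] := fP k; have [Sk1 _] := fP k.+1; have zk1 := fS k.
  have := aS ((f k.+1).2 - (f k).2) _ (lin_subspaceB subS Sk1 Sk).
  have -> : (f k.+1).1 - (f k.+1).2 *: e - ((f k).1 - (f k).2 *: e) +
     ((f k.+1).2 - (f k).2) *: e = (f k.+1).1 - (f k).1.
    rewrite scalerBl; set a := (f k.+1).2 *: e; set b := (f k).2 *: e.
    by rewrite opprD opprK addrACA addrNK addrK.
  have := rnorm_dist z (f k.+1).1 (f k).1; rewrite [rnorm (_ - z)]rnormBC.
  move=> tri le_d.
  have : cabs ((f k.+1).2 - (f k).2) <= 2 / d * 2^-1 ^+ k.
    by rewrite mulrAC ler_pdivlMr //; lra.
  by move/(ler_wpM2r (rnorm_ge0 e)); rewrite mulrAC.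
- by move=> k; rewrite /r exprSr mulrA.
have [a wa] : exists a, w = a *: e.
  apply: closure_line; apply/closure_rnormP => h h0.
  have [|k rk] := @halving_small R (fun k => 2 * r k) _ h h0.
    by move=> k; rewrite /r exprSr; lra.
  by exists ((f k).2 *: e); [exists (f k).2|apply: le_lt_trans rk].
exists a; rewrite -wa; apply/closure_rnormP => h h0.
have [|k rk] := @halving_small R (fun k => 2 * r k + 2^-1 ^+ k) _ h h0.
  by move=> k; rewrite /r exprSr; lra.
have [Sk zk] := fP k; exists ((f k).1 - (f k).2 *: e) => //.
have -> : z - w - ((f k).1 - (f k).2 *: e) = (z - (f k).1) - (w - (f k).2 *: e).
  by rewrite !opprB addrACA [RHS]addrACA [- w + _]addrC.
by apply: le_lt_trans (rnormB _ _) _; have := wP k; lra.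
Qed.

Lemma closure_add_span n (e : 'I_n -> V) (S : set V) (z : V) : lin_subspace S ->
  closure [set w | exists c : 'I_n -> R[i], S (w - \sum_i c i *: e i)] z ->
  exists c : 'I_n -> R[i], closure S (z - \sum_i c i *: e i).
Proof.
elim: n e S z => [|n IHn] e S z subS cz.
  exists (fun=> 0); rewrite big_ord0 subr0; apply: closureS cz => w [c].
  by rewrite big_ord0 subr0.
have [|c cS] := IHn (e \o lift ord0) _ z (lin_subspace_add_line (e ord0) subS).
  apply: closureS cz => w [c Sw]; exists (c \o lift ord0), (c ord0).
  by move: Sw; rewrite big_ord_recl opprD addrAC addrA addrAC.
have [a Sa] := closure_add_line subS cS.
exists (fun i => if unlift ord0 i is Some j then c j else a).
rewrite big_ord_recl unlift_none opprD addrA addrAC.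
by under eq_bigr => i _ do rewrite liftK.
Qed.

End FiniteExtension.

(** * Closed operators with closed range and finite-dimensional kernel *)

Definition closed_graph (K : numFieldType) (U V : normedModType K)
    (T : linop U V) : Prop :=
  closure (op_graph T) `<=` op_graph T.

Section Operators.
Variables (K : fieldType) (U V : lmodType K) (T : linop U V).

Lemma lin_subspace_dom : lin_subspace (op_dom T).
Proof. by split; [exact: op_dom0|move=> a x y; exact: op_domP]. Qed.

Lemma linear_on_op : linear_on (op_dom T) T.
Proof. by move=> a x y; exact: op_linear. Qed.

Lemma lin_subspace_graph : lin_subspace (op_graph T).
Proof.
split; first by split; [exact: op_dom0|exact: op_fun0].
move=> a [x u] [y v] [/= dx <-] [/= dy <-]; split=> /=; first exact: op_domP.
exact: op_linear.
Qed.

Lemma op_ranE : op_ran T = snd @` op_graph T.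
Proof.
apply/seteqP; split=> [_ [x dx <-]|_ [[x y] [/= dx <-] <-]]; last by exists x.
by exists (x, T x).
Qed.

End Operators.

Section BoundedBelow.
Variable R : realType.

(** The subspace [S] need not be closed, nor the codimension be witnessed by
    continuous functionals. *)
Definition cofinitely_bounded_below (U V : normedModType R[i])
    (T : linop U V) : Prop :=
  exists S, [/\ lin_subspace S, S `<=` op_dom T, cofinite_in (op_dom T) S &
    exists2 c : R, 0 <= c & forall x, S x -> rnorm x <= c * rnorm (T x)].

Variables (U V : hilbertType R) (T : linop U V).
Hypothesis clT : closed_graph T.

(** The lower bound turns a convergent sequence of values into a convergent
    sequence of arguments, and the graph is closed. *)
Lemma closure_image_bounded_below (S : set U) (c : R) :
  lin_subspace S -> S `<=` op_dom T -> 0 <= c ->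
  (forall x, S x -> rnorm x <= c * rnorm (T x)) ->
  closure (T @` S) `<=` op_ran T.
Proof.
move=> subS Sdom c0 below y /closure_rnormP cy.
have pick k : exists x, S x /\ rnorm (y - T x) < 2^-1 ^+ k.
  have k0 : 0 < (2^-1 : R) ^+ k by rewrite exprn_gt0 // invr_gt0.
  by have [_ [x Sx <-] yx] := cy _ k0; exists x.
have [x xP] := choice pick.
have [||l lx] := @cvg_halving R U x (fun k => 2 * c * 2^-1 ^+ k).
- move=> k; have [Sk yk] := xP k; have [Sk1 yk1] := xP k.+1.
  apply: le_trans (below _ (lin_subspaceB subS Sk1 Sk)) _.
  rewrite [2 * c]mulrC -mulrA; apply: ler_wpM2l => //.
  rewrite (linear_onB (@linear_on_op _ _ _ T)); [|exact: Sdom..].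
  have := rnorm_dist y (T (x k.+1)) (T (x k)); rewrite [rnorm (_ - y)]rnormBC.
  move: yk1; rewrite exprSr; have := rnorm_ge0 (y - T (x k)); lra.
- by move=> k; rewrite exprSr mulrA.
suff [dl Tl] : op_graph T (l, y) by exists l.
apply: clT; apply/closure_prod_rnormP => e e0.
have [|k rk] := @halving_small R (fun k => 4 * c * 2^-1 ^+ k + 2^-1 ^+ k) _ e e0.
  by move=> k; rewrite exprSr; lra.
have k0 : 0 <= (2^-1 : R) ^+ k by rewrite exprn_ge0 // invr_ge0.
have ck0 := mulr_ge0 c0 k0.
have [Sk yk] := xP k; exists (x k), (T (x k)); split.
- by split=> //; exact: Sdom.
- by have := lx k; lra.
- by lra.
Qed.

(** If [T] has closed range, every value has a preimage of controlled norm
    ([bounded_lifting]); on the orthogonal complement [S] of the kernel the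
    actual argument is the preimage of least norm, whence the lower bound.
    Conversely, the kernel meets [S] in 0 only, and the range is the sum of
    [T @` S], whose closure consists of values of [T], and of finitely many
    lines. *)
Lemma cofinitely_bounded_belowP :
  closed (op_ran T) /\ finite_dim (op_ker T) <-> cofinitely_bounded_below T.
Proof.
split=> [[clR [n [k [kT kP]]]]|[S [subS Sdom cofS [c c0 below]]]]; last first.
  have linT := @linear_on_op _ _ _ T.
  have subdom := lin_subspace_dom T.
  have [n [e [de eP]]] := cofS.
  split.
    suff cl : closure (op_ran T) `<=` op_ran T.
      rewrite closure_id; apply/seteqP; split=> //; exact: subset_closure.
    move=> y cy.
    have subTS : lin_subspace (T @` S).
      by apply: lin_subspace_image => // a u v /Sdom du /Sdom dv; exact: linT.
    have [|d] := closure_add_span (e := T \o e) (z := y) subTS.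
      apply: closureS cy => _ [x dx <-].
      have [d Sd] := eP x dx; exists d, (x - \sum_i d i *: e i) => //.
      rewrite (linear_onB linT) //; last exact: lin_subspace_sum.
      by rewrite (linear_on_sum subdom linT).
    move=> /(closure_image_bounded_below subS Sdom c0 below)[x dx Tx].
    exists (x + \sum_i d i *: e i).
      by apply: lin_subspaceD => //; exact: lin_subspace_sum.
    rewrite -[x]scale1r linT //; last exact: lin_subspace_sum.
    by rewrite scale1r Tx (linear_on_sum subdom linT) //= addrNK.
  have subker : lin_subspace (op_ker T).
    split; first by split; [exact: op_dom0|exact: op_fun0].
    move=> a x y [dx Tx] [dy Ty]; split; first exact: op_domP.
    by rewrite op_linear // Tx Ty scaler0 addr0.
  have [||m [f [fker fP]]] :=
      @cofinite_in_preimage _ _ _ (op_ker T) id S n e subker _ subS.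
  - by [].
  - by move=> x [dx _]; exact: eP.
  exists m, f; split=> // x xker; have [d [[dd Td] Sd]] := fP x xker.
  exists d; apply/eqP; rewrite -subr_eq0; apply/eqP; apply: rnorm0_eq0.
  apply/eqP; rewrite eq_le rnorm_ge0 andbT.
  by apply: le_trans (below _ Sd) _; rewrite Td rnorm0 mulr0.
have [c c0 lift] : exists2 c : R, 0 <= c & forall v, op_ran T v ->
    exists2 u, op_graph T (u, v) & rnorm u <= c * rnorm v.
  rewrite op_ranE; apply: bounded_lifting => //; first exact: lin_subspace_graph.
  by rewrite -op_ranE => v; apply: clR.
(* The orthogonal complement of the kernel is the kernel of [L]. *)
pose L (x : U) : 'rV[R[i]]_n := \row_j inner x (k j).
have linL : linear_on (op_dom T) L.
  by move=> a x y _ _; apply/rowP => j; rewrite !mxE innerDl innerZl.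
have sub0 : lin_subspace [set 0 : 'rV[R[i]]_n].
  by split=> // a x y -> ->; rewrite scaler0 addr0.
exists (op_dom T `&` L @^-1` [set 0]); split.
- exact: lin_subspace_preimage (lin_subspace_dom T) linL _ sub0.
- by move=> x [].
- apply: (@cofinite_in_preimage _ _ _ _ _ _ n (fun j => delta_mx 0 j)) => //.
    exact: lin_subspace_dom.
  by move=> x _; exists (fun j => L x 0 j); rewrite /= {1}[L x]row_sum_delta subrr.
exists c => // x [dx /= Lx].
have [|u [/= du Tu] uc] := lift (T x); first by exists x.
apply: le_trans uc.
have [|d dP] := kP (u - x).
  split; first by apply: lin_subspaceB => //; exact: lin_subspace_dom.
  by rewrite (linear_onB (@linear_on_op _ _ _ T)) // Tu subrr.
have -> : u = x + (u - x) by rewrite addrC addrNK.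
apply: rnorm_orthogonal; rewrite dP.
have -> : inner x (\sum_i d i *: k i) = \sum_i inner x (d i *: k i) by exact: linear_sumr.
rewrite big1 // => j _; rewrite innerZr.
by have /rowP/(_ j) := Lx; rewrite !mxE => ->; rewrite mulr0.
Qed.

End BoundedBelow.

(** * Shifts, closures and resolvents *)

Lemma closed_graph_closure (K : numFieldType) (U V : normedModType K)
    (T : linop U V) (clT : closable T) : closed_graph (op_closure clT).
Proof.
rewrite /closed_graph op_closure_graph.
by have /closure_id <- := @closed_closure _ (op_graph T).
Qed.

Section Shift.
Variables (R : realType) (V : normedModType R[i]).
Implicit Types T : linop V V.

Lemma op_graph_shift T l x v :
  op_graph (op_shift T l) (x, v) <-> op_graph T (x, v + l *: x).
Proof.
split=> -[/= dx Tx]; split=> //=; first by rewrite -Tx addrNK.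
by rewrite Tx addrK.
Qed.

Lemma closure_graph_shift T l x v :
  closure (op_graph T) (x, v) -> closure (op_graph (op_shift T l)) (x, v - l *: x).
Proof.
move=> /closure_prod_rnormP cT; apply/closure_prod_rnormP => e e0.
have l0 := cabs_ge0 l; have l1 : 0 < 1 + cabs l by rewrite ltr_pwDl.
pose d := e / (1 + cabs l).
have d0 : 0 < d by rewrite divr_gt0.
have dE : d + cabs l * d = e by rewrite /d; field; rewrite gt_eqF.
have ld := mulr_ge0 l0 (ltW d0).
have [y [w [Tyw xy vw]]] := cT _ d0.
exists y, (w - l *: y); split.
- by apply/op_graph_shift; rewrite addrNK.
- by lra.
have -> : v - l *: x - (w - l *: y) = (v - w) - l *: (x - y).
  by rewrite scalerBr !opprB addrACA [RHS]addrACA [- _ + _]addrC.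
apply: le_lt_trans (rnormB _ _) _; rewrite rnormZ.
by have := ler_wpM2l l0 (ltW xy); lra.
Qed.

Lemma closed_graph_shift T l : closed_graph T <-> closed_graph (op_shift T l).
Proof.
split=> [clT [x v] cx|clT [x v] cx]; last first.
  by have /clT/op_graph_shift := closure_graph_shift (l := l) cx; rewrite addrNK.
apply/op_graph_shift; apply: clT.
have := closure_graph_shift (l := - l) cx; rewrite scaleNr opprK.
apply: closureS => -[y w] /op_graph_shift/op_graph_shift.
by rewrite scaleNr addrNK.
Qed.

Lemma sigma_e2_graph T T' : op_graph T = op_graph T' -> sigma_e2 T = sigma_e2 T'.
Proof.
move=> TT'; have shiftE l : op_graph (op_shift T l) = op_graph (op_shift T' l).
  apply/seteqP; split=> -[x v] /op_graph_shift; [rewrite TT'|rewrite -TT'];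
    by move/op_graph_shift.
have kerE l : op_ker (op_shift T l) = op_ker (op_shift T' l).
  apply/seteqP; split=> x kx.
    by have : op_graph (op_shift T' l) (x, 0) by rewrite -shiftE.
  by have : op_graph (op_shift T l) (x, 0) by rewrite shiftE.
by rewrite /sigma_e2; apply/seteqP; split=> l /=;
  rewrite !op_ranE shiftE kerE.
Qed.

Lemma resolvent_set_bounded T l : resolvent_set T l ->
  op_ran (op_shift T l) = setT /\ exists2 c : R, 0 <= c &
    forall x, op_dom T x -> rnorm x <= c * rnorm (op_shift T l x).
Proof.
move=> [[_ _ sur] [M MP]]; split.
  by apply/seteqP; split=> // v /sur.
exists (cabs M) => [|x dx]; first exact: cabs_ge0.
have xM := MP x dx.
move: (xM); rewrite -(ger0_norm (le_trans (normr_ge0 x) xM)) normrM normr_id.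
by rewrite cabsE !rnormE -rmorphM lecR.
Qed.

Lemma resolvent_set_closed T l : resolvent_set T l -> closed_graph T.
Proof.
move=> /resolvent_set_bounded[surT [c c0 below]].
apply/(closed_graph_shift T l) => -[x v] /closure_prod_rnormP cx.
have [x' dx' Tx'] : op_ran (op_shift T l) v by rewrite surT.
suff -> : x = x' by [].
apply/eqP; rewrite -subr_eq0; apply/eqP; apply: (@eq0_small _ _ (1 + c)) => e e0.
have [y [_ [[/= dy <-] xy vy]]] := cx e e0.
apply: le_trans (rnorm_dist y _ _) _.
have subd := lin_subspace_dom T.
have := below (y - x') (lin_subspaceB subd dy dx').
rewrite (linear_onB (@linear_on_op _ _ _ (op_shift T l))) // Tx' [rnorm (_ - v)]rnormBC.
by have := ler_wpM2l c0 (ltW vy); lra.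
Qed.

End Shift.

Lemma sigma_e2P (R : realType) (H : hilbertType R) (T : linop H H) l :
  closed_graph T -> ~ sigma_e2 T l <-> cofinitely_bounded_below (op_shift T l).
Proof.
move=> /(closed_graph_shift T l) clT; rewrite -cofinitely_bounded_belowP //.
by split=> [/contrapT|h nh]; last exact: nh.
Qed.

(** Composed with the resolvent of [A], the operator [C] becomes everywhere
    defined with closed graph, so the closed graph theorem applies; here it is
    [bounded_lifting] for the relation of all [(C x, (A - l) x)]. *)
Lemma relatively_bounded (R : realType) (H1 H2 : hilbertType R)
    (A : linop H1 H1) (C : linop H1 H2) :
  closable C -> op_dom A `<=` op_dom C -> resolvent_set A !=set0 ->
  exists2 k : R, 0 <= k &
    forall x, op_dom A x -> rnorm (C x) <= k * (rnorm x + rnorm (A x)).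
Proof.
move=> clC domAC [l rhoA]; have [surA [c c0 below]] := resolvent_set_bounded rhoA.
set A' := op_shift A l in surA below.
pose L x : H2 * H1 := (C x, A' x).
have linA' := @linear_on_op _ _ _ A'.
have linL : linear_on (op_dom A) L.
  move=> a x y dx dy; rewrite /L linA' //.
  by rewrite (linear_on_op (T := C)) //; exact: domAC.
have sndL : snd @` (L @` op_dom A) = setT.
  apply/seteqP; split=> // v _; have : op_ran A' v by rewrite surA.
  by move=> [x dx <-]; exists (L x) => //; exists x.
have [|||k k0 kP] := @bounded_lifting R H2 H1 (L @` op_dom A).
- exact: lin_subspace_image (lin_subspace_dom A) linL.
- move=> [u v] /closure_prod_rnormP cuv.
  have [x dx A'x] : op_ran A' v by rewrite surA.
  exists x => //; rewrite /L A'x; congr pair.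
  apply/eqP; rewrite eq_sym -subr_eq0; apply/eqP; apply: clC.
  apply/closure_prod_rnormP => e e0.
  have c1 : 0 < 1 + c by rewrite ltr_pwDl.
  pose d := e / (1 + c); have d0 : 0 < d by rewrite divr_gt0.
  have dE : d + c * d = e by rewrite /d; field; rewrite gt_eqF.
  have cd := mulr_ge0 c0 (ltW d0).
  have [_ [_ [[y dy [<- <-]] uy vy]]] := cuv d d0.
  have dyx := lin_subspaceB (lin_subspace_dom A) dy dx.
  exists (y - x), (C (y - x)); split.
  + by split=> //; exact: domAC.
  + rewrite sub0r rnormN.
    have := below _ dyx; rewrite (linear_onB linA') // A'x [rnorm (_ - v)]rnormBC.
    by have := ler_wpM2l c0 (ltW vy); lra.
  + rewrite (linear_onB (@linear_on_op _ _ _ C)); [|exact: domAC..].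
    by rewrite opprB addrA addrNK; lra.
- by rewrite sndL.
have l0 := cabs_ge0 l.
exists (k * (1 + cabs l)) => [|x dx]; first by rewrite mulr_ge0 // addr_ge0.
have [_ [y dy [<- A'y]]] := kP (A' x) (ex_intro2 _ _ (L x) (ex_intro2 _ _ x dx erefl) erefl).
have {}A'y : A' y = A' x by exact: A'y.
have -> : x = y.
  have := below _ (lin_subspaceB (lin_subspace_dom A) dx dy).
  rewrite (linear_onB linA') // A'y subrr rnorm0 mulr0 => xy.
  apply/eqP; rewrite -subr_eq0; apply/eqP/rnorm0_eq0/eqP.
  by rewrite eq_le xy rnorm_ge0.
move=> Cy; apply: le_trans Cy _; rewrite -mulrA ler_wpM2l //.
have := rnormB (A y) (l *: y); rewrite rnormZ -/(op_shift A l y).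
have := mulr_ge0 l0 (rnorm_ge0 (A y)); have := rnorm_ge0 y.
by rewrite /A' /=; lra.
Qed.

(** * Lower triangular operator matrices *)

Section Triangular.
Variables (R : realType) (H1 H2 : hilbertType R).
Variables (A : linop H1 H1) (C : linop H1 H2).
Hypothesis domAC : op_dom A `<=` op_dom C.

Lemma rnorm_fst (z : hsum H1 H2) : rnorm z.1 <= rnorm z.
Proof. by rewrite -lecR -!rnormE; exact: hsum_norm_ge1. Qed.

Lemma rnorm_snd (z : hsum H1 H2) : rnorm z.2 <= rnorm z.
Proof. by rewrite -lecR -!rnormE; exact: hsum_norm_ge2. Qed.

Lemma rnorm_hsum_le (z : hsum H1 H2) : rnorm z <= rnorm z.1 + rnorm z.2.
Proof. by rewrite -lecR rmorphD /= -!rnormE; exact: hsum_norm_le. Qed.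

Section Closure.
Hypothesis clA : closed_graph A.
Variable k : R.
Hypothesis k0 : 0 <= k.
Hypothesis bndC :
  forall x, op_dom A x -> rnorm (C x) <= k * (rnorm x + rnorm (A x)).

(** A sequence of arguments for which the first components converge in the graph
    of [A] has convergent images under [C], because [C] is relatively bounded;
    subtracting them isolates the graph of [D]. *)
Lemma closure_graph_tri (D : linop H2 H2) (z w : hsum H1 H2) :
  closure (op_graph (lower_tri D domAC)) (z, w) <->
  op_graph A (z.1, w.1) /\ closure (op_graph D) (z.2, w.2 - C z.1).
Proof.
case: z w => x y [u v] /=; split=> [/closure_prod_rnormP cM|[[/= dx Ax] /closure_prod_rnormP cD]].
  have [/= dx Ax] : op_graph A (x, u).
    apply: clA; apply/closure_prod_rnormP => e e0.
    have [p [_ [[/= [dp1 dp2] <-] zp wp]]] := cM e e0.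
    exists p.1, (A p.1); split=> //.
      exact: le_lt_trans (rnorm_fst ((x, y) - p)) zp.
    exact: le_lt_trans (rnorm_fst ((u, v) - tri_fun A C D p)) wp.
  split=> //; apply/closure_prod_rnormP => e e0.
  have k1 : 0 < 1 + k * 2 by rewrite ltr_pwDl // mulr_ge0.
  pose d := e / (1 + k * 2); have d0 : 0 < d by rewrite divr_gt0.
  have dE : d + k * (d + d) = e by rewrite /d; field; rewrite gt_eqF.
  have kd : 0 <= k * (d + d) by rewrite mulr_ge0 // addr_ge0 // ltW.
  have [[p q] [_ [[/= [dp dq] <-] zp wp]]] := cM d d0.
  have xp := le_lt_trans (rnorm_fst ((x, y) - (p, q))) zp.
  have yq := le_lt_trans (rnorm_snd ((x, y) - (p, q))) zp.
  have up := le_lt_trans (rnorm_fst ((u, v) - tri_fun A C D (p, q))) wp.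
  have vq := le_lt_trans (rnorm_snd ((u, v) - tri_fun A C D (p, q))) wp.
  rewrite /= in xp yq up vq *.
  exists q, (D q); split; [by []|by lra|].
  have -> : v - C x - D q = (v - (C p + D q)) - (C x - C p).
    by rewrite opprD opprB [v + (_ + _)]addrA [RHS]addrACA addrNK addrA addrAC.
  apply: le_lt_trans (rnormB _ _) _.
  have := bndC (lin_subspaceB (lin_subspace_dom A) dx dp).
  rewrite (linear_onB (@linear_on_op _ _ _ A)) // Ax.
  rewrite (linear_onB (@linear_on_op _ _ _ C)); [|exact: domAC..] => CB.
  have : rnorm (x - p) + rnorm (u - A p) <= d + d by lra.
  by move/(ler_wpM2l k0); lra.
apply/closure_prod_rnormP => e e0; have [q [_ [[/= dq <-] yq vq]]] := cD e e0.
exists (x, q), (tri_fun A C D (x, q)); split => //.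
  apply: le_lt_trans (rnorm_hsum_le _) _ => /=.
  by rewrite subrr rnorm0 add0r.
apply: le_lt_trans (rnorm_hsum_le _) _ => /=.
by rewrite Ax subrr rnorm0 add0r opprD addrA.
Qed.

Lemma closable_tri (D : linop H2 H2) : closable D -> closable (lower_tri D domAC).
Proof.
move=> clD w /closure_graph_tri[[/= _ w1] cD].
have w10 : w.1 = 0 by rewrite -w1 op_fun0.
have w20 : w.2 = 0 by apply: clD; move: cD; rewrite /= op_fun0 subr0.
by case: w w10 w20 {w1 cD} => ? ? /= -> ->.
Qed.

Lemma graph_closure_tri (D : linop H2 H2) (clD : closable D)
    (clM : closable (lower_tri D domAC)) :
  op_graph (op_closure clM) = op_graph (lower_tri (op_closure clD) domAC).
Proof.
rewrite op_closure_graph; apply/seteqP; split=> -[[x y] [u v]].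
  move=> /closure_graph_tri[[/= dx Ax]]; rewrite -(op_closure_graph clD) => -[dy Dy].
  split=> //; rewrite /= /tri_fun /= Ax; congr pair.
  by move: Dy => /= ->; rewrite addrC addrNK.
move=> [/= [dx dy] [Ax Dy]]; apply/closure_graph_tri; split=> //=.
by rewrite -(op_closure_graph clD); split=> //=; rewrite -Dy addrC addKr.
Qed.

End Closure.

Variables (D : linop H2 H2) (l : R[i]).
Local Notation T := (op_shift (lower_tri D domAC) l).

Let triE (x : H1) (y : H2) :
  T (x, y) = (op_shift A l x, C x + op_shift D l y).
Proof. by congr pair; rewrite /= addrA. Qed.

Let linA := @linear_on_op _ _ _ A.
Let linC := @linear_on_op _ _ _ C.

(** From [T (x, y)] the first component bounds [x], hence [A x] and [C x]; then
    subtracting [C x] from the second component bounds [y]. *)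
Lemma tri_bounded_below_diag (k : R) : 0 <= k ->
  (forall x, op_dom A x -> rnorm (C x) <= k * (rnorm x + rnorm (A x))) ->
  cofinitely_bounded_below (op_shift A l) ->
  cofinitely_bounded_below (op_shift D l) -> cofinitely_bounded_below T.
Proof.
move=> k0 bndC [S1 [sub1 dom1 cof1 [c1 c10 below1]]].
move=> [S2 [sub2 dom2 cof2 [c2 c20 below2]]].
have lin1 X : linear_on X (fst : hsum H1 H2 -> H1) by [].
have lin2 X : linear_on X (snd : hsum H1 H2 -> H2) by [].
have subT := lin_subspace_dom T.
pose X1 := op_dom T `&` fst @^-1` S1.
have subX1 : lin_subspace X1 by exact: lin_subspace_preimage subT (lin1 _) _ sub1.
pose X2 := X1 `&` snd @^-1` S2.
exists X2; split.
- exact: lin_subspace_preimage subX1 (lin2 _) _ sub2.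
- by move=> z [[]].
- apply: (@cofinite_in_trans _ _ _ X1) => [z []//||].
    have [n [e [_ eP]]] := cof1.
    by apply: (cofinite_in_preimage subT (lin1 _) sub1) => z [dz _]; exact: eP _ dz.
  have [n [e [_ eP]]] := cof2.
  by apply: (cofinite_in_preimage subX1 (lin2 _) sub2) => z [[_ dz] _]; exact: eP _ dz.
have l0 := cabs_ge0 l.
(* [c3] is the bound of [C x] in terms of [T (x, y)]: relative boundedness
   with [|x| <= c1 N] and [|A x| <= N + |l| c1 N]. *)
set c3 := k * (c1 + (1 + cabs l * c1)).
have c30 : 0 <= c3 by rewrite /c3 mulr_ge0 // ?addr_ge0 // mulr_ge0.
exists (c1 + c2 * (1 + c3)); first by rewrite addr_ge0 // mulr_ge0 // addr_ge0.
move=> [x y] [[[/= dx dy] Sx] Sy]; rewrite /= in Sx Sy.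
set N := rnorm (T (x, y)).
have aN : rnorm (op_shift A l x) <= N by exact: (rnorm_fst (T (x, y))).
have bN : rnorm (C x + op_shift D l y) <= N.
  by rewrite /N triE; exact: (rnorm_snd (_, C x + op_shift D l y)).
have xN : rnorm x <= c1 * N by apply: le_trans (below1 x Sx) _; rewrite ler_wpM2l.
have AN : rnorm (A x) <= N + cabs l * (c1 * N).
  rewrite -[A x](addrNK (l *: x)).
  apply: le_trans (rnormD _ _) _; rewrite rnormZ lerD // ler_wpM2l //.
have CN : rnorm (C x) <= c3 * N.
  apply: le_trans (bndC x dx) _; rewrite /c3 -mulrA ler_wpM2l //.
  by rewrite !mulrDl mul1r -mulrA lerD.
have yN : rnorm y <= c2 * ((1 + c3) * N).
  apply: le_trans (below2 y Sy) _; rewrite ler_wpM2l //.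
  rewrite -[op_shift D l y](addKr (C x)) addrC.
  by apply: le_trans (rnormB _ _) _; rewrite mulrDl mul1r lerD.
apply: le_trans (rnorm_hsum_le _) _.
by rewrite mulrDl -mulrA lerD.
Qed.

(** On the vectors [(0, y)] the operator [T] acts as [D - l]. *)
Lemma tri_bounded_below_snd :
  cofinitely_bounded_below T -> cofinitely_bounded_below (op_shift D l).
Proof.
move=> [S [subS domS cofS [c c0 below]]].
pose L (y : H2) : hsum H1 H2 := (0, y).
have linL X : linear_on X L.
  by move=> a x y _ _; congr pair; rewrite /= scaler0 addr0.
have subD := lin_subspace_dom D.
exists (op_dom D `&` L @^-1` S); split.
- exact: lin_subspace_preimage subD (linL _) _ subS.
- by move=> y [].
- have [n [e [_ eP]]] := cofS.
  apply: (cofinite_in_preimage subD (linL _) subS) => y dy.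
  by apply: eP; split=> //; exact: op_dom0.
exists c => // y [dy Sy].
apply: le_trans (rnorm_snd (L y)) _; apply: le_trans (below _ Sy) _.
rewrite ler_wpM2l // triE; apply: le_trans (rnorm_hsum_le _) _.
rewrite [(_, _).1]/= [(_, _).2]/=.
by rewrite /= !op_fun0 scaler0 subrr rnorm0 !add0r.
Qed.

(** Let [Y] be the space of the pairs [(x, y)] with [C x + (D - l) y = 0]. It
    projects onto the [x] with [C x] in the range of [D - l], a subspace of
    finite codimension in [op_dom A]; and [S] has finite codimension in it when
    intersected with [Y]. Hence the projection of the intersection of [Y] and
    [S] has finite codimension, and on it [|x|] is at most [|(x, y)|], which is
    bounded by a multiple of the norm of [T (x, y) = ((A - l) x, 0)]. *)
Lemma tri_bounded_below_fst :
  finite_codim (op_ran (op_shift D l)) ->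
  cofinitely_bounded_below T -> cofinitely_bounded_below (op_shift A l).
Proof.
move=> [m [f fP]] [S [subS domS cofS [c c0 below]]].
set D' := op_shift D l.
have linD' := @linear_on_op _ _ _ D'.
have subT := lin_subspace_dom T.
pose P2 (z : hsum H1 H2) := C z.1 + D' z.2.
have linP2 : linear_on (op_dom T) P2.
  move=> a z w [/= dz1 dz2] [/= dw1 dw2]; rewrite /P2 linD' // linC; try exact: domAC.
  by rewrite [a *: (C _ + _)]scalerDr addrACA.
have sub0 : lin_subspace [set 0 : H2].
  by split=> // a x y -> ->; rewrite scaler0 addr0.
pose Y := op_dom T `&` P2 @^-1` [set 0].
have subY : lin_subspace Y by exact: lin_subspace_preimage subT linP2 _ sub0.
have linI X : linear_on X (id : hsum H1 H2 -> hsum H1 H2) by [].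
pose Y0 := Y `&` S.
have subY0 : lin_subspace Y0 by exact: lin_subspace_preimage subY (linI _) _ subS.
have cofY : cofinite_in Y Y0.
  have [n [e [_ eP]]] := cofS.
  by apply: (cofinite_in_preimage subY (linI _) subS) => z [dz _]; exact: eP _ dz.
have lin1 X : linear_on X (fst : hsum H1 H2 -> H1) by [].
have subD := lin_subspace_dom D'.
have oppD y : op_dom D' y -> op_dom D' (- y) /\ D' (- y) = - D' y.
  move=> dy; rewrite -[- y]sub0r; split; first exact: lin_subspaceB subD.1 dy.
  by rewrite (linear_onB linD' subD.1 dy) (linear_on0 subD linD') sub0r.
have subran : lin_subspace (op_ran D') by exact: lin_subspace_image subD linD'.
have subA := lin_subspace_dom A.
have linCA : linear_on (op_dom A) C by move=> a x y /domAC dx /domAC; exact: linC.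
have fstY : fst @` Y = op_dom A `&` C @^-1` op_ran D'.
  apply/seteqP; split=> [_ [[x y] [[/= dx dy] P0] <-]|x [dx [y dy Dy]]].
    split=> //=; have [dNy DNy] := oppD y dy; exists (- y) => //.
    by rewrite DNy; apply/esym/eqP; rewrite -addr_eq0; apply/eqP.
  have [dNy DNy] := oppD y dy; exists (x, - y) => //; split=> //.
  by rewrite /preimage /P2 /mkset DNy Dy subrr.
exists (fst @` Y0); split.
- exact: lin_subspace_image subY0 (lin1 _).
- by move=> _ [z [[[d1 _] _] _] <-].
- apply: (@cofinite_in_trans _ _ _ (fst @` Y)).
  + by move=> _ [z [[d1 _] _] <-].
  + rewrite fstY; apply: (cofinite_in_preimage subA linCA subran (e := f)).
    by move=> x _; exact: fP.
  + by apply: cofinite_in_image => // z [].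
exists c => // _ [[x y] [[_ P0] Sz] <-] /=.
apply: le_trans (rnorm_fst (x, y)) _; apply: le_trans (below _ Sz) _.
rewrite ler_wpM2l // triE; apply: le_trans (rnorm_hsum_le _) _.
have -> : C x + op_shift D l y = 0 by exact: P0.
by rewrite /= rnorm0 addr0.
Qed.

End Triangular.

Theorem theorem8p1 (R : realType) (H1 H2 : hilbertType R)
  (A : linop H1 H1) (C : linop H1 H2) (D : linop H2 H2)
  (A_dense : dense (op_dom A)) (D_dense : dense (op_dom D))
  (C_closable : closable C) (D_closable : closable D)
  (domAC : op_dom A `<=` op_dom C)
  (rhoA : resolvent_set A !=set0) :
  exists M_closable : closable (lower_tri D domAC),
    let Mbar := op_closure M_closable in
    let Dbar := op_closure D_closable in
    [/\ (sigma_e2 A `\` sigma_e2_star Dbar) `|` sigma_e2 Dbar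
          `<=` sigma_e2 Mbar,
        sigma_e2 Mbar `<=` sigma_e2 A `|` sigma_e2 Dbar,
        sigma_e2 Mbar `|` (sigma_e2 A `&` sigma_e2_star Dbar)
          = sigma_e2 A `|` sigma_e2 Dbar &
        sigma_e2_star Dbar = sigma_e2 Dbar \/
          sigma_e2 A `&` sigma_e2_star Dbar = set0 ->
        sigma_e2 Mbar = sigma_e2 A `|` sigma_e2 Dbar].
Proof.
have [k k0 bndC] := relatively_bounded C_closable domAC rhoA.
have clA : closed_graph A by case: rhoA => mu; exact: resolvent_set_closed.
exists (closable_tri (domAC := domAC) clA k0 bndC D_closable) => Mbar Dbar.
have clD : closed_graph Dbar by exact: closed_graph_closure.
have MbarE : op_graph Mbar = op_graph (lower_tri Dbar domAC).
  exact: (graph_closure_tri clA k0 bndC).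
have clM : closed_graph (lower_tri Dbar domAC).
  by rewrite /closed_graph -MbarE; exact: closed_graph_closure.
rewrite (sigma_e2_graph MbarE).
set sM := sigma_e2 (lower_tri _ _); set sA := sigma_e2 A.
set sD := sigma_e2 Dbar; set sD' := sigma_e2_star Dbar.
have lower : (sA `\` sD') `|` sD `<=` sM.
  move=> l sl; apply: contrapT => /(sigma_e2P _ clM) bM.
  case: sl => [[sAl /contrapT[_ codim]]|sDl].
    by move: sAl; apply/(sigma_e2P _ clA); exact: tri_bounded_below_fst codim bM.
  by move: sDl; apply/(sigma_e2P _ clD); exact: tri_bounded_below_snd bM.
have upper : sM `<=` sA `|` sD.
  move=> l sMl; apply: contrapT => /not_orP[/(sigma_e2P _ clA) bA /(sigma_e2P _ clD) bD].
  move: sMl; apply/(sigma_e2P _ clM); exact: tri_bounded_below_diag k0 bndC bA bD.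
have sD_sM l : sD l -> sM l by move=> ?; apply: lower; right.
have sA_sM l : sA l -> ~ sD' l -> sM l by move=> ? ?; apply: lower; left.
split=> //.
- apply/seteqP; split=> l; first by case=> [/upper|[]]; [|left].
  by case=> [sAl|/sD_sM]; [have [|/(sA_sM l sAl)] := pselect (sD' l); [right|left]|left].
- move=> sDA; apply/seteqP; split=> // l [sAl|/sD_sM //].
  have [sDl|] := pselect (sD' l); last exact: sA_sM.
  case: sDA => [sDE|sAD0]; first by apply: sD_sM; rewrite -sDE.
  by have : (sA `&` sD') l by []; rewrite sAD0.
Qed.
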